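(* Let $G$ be a connected graph on a (finite, nonempty) totally ordered vertex set $V$ with smallest element $r$, and let $R$ be an increasing $G$-connected tree on $V$. Then the following are equivalent: (1) $k(G)=R$. (2) For each vertex $v\in V$, the graph $G|_{\mathrm{des}(v,R)}$, rooted at $v$, is connected and has the same depth-first partition as $R|_{\mathrm{des}(v,R)}$ rooted at $v$. (3) For each non-root vertex $v\in V-\{r\}$ there is a nonempty set $E(v)\subseteq J(v,R)$ such that $G=\bigcup_{v\in V-\{r\}}E(v)$.
   Context: All graphs are finite labeled simple graphs; a graph on $V$ is identified with its edge set (a set of 2-element subsets of $V$). For $S\subseteq V$, $G|_S$ is the graph on $S$ whose edges are all edges of $G$ with both ends in $S$. For a graph $G$ on $V$, $s(G)$ is the set partition of $V$ in which two vertices are in the same block if and only if they are joined by a path in $G$. A rooted graph is a graph with a distinguished vertex (the root). If $G$ is a rooted connected graph on $V$ with root $r$, its depth-first partition is the set partition $s(G|_{V-\{r\}})$ of $V-\{r\}$. For a rooted tree $R$ on $V$: the height of a vertex is its distance from the root; $w$ is a descendant of $v$ if the heights along the unique path from $v$ to $w$ are increasing (so $v$ is a descendant of itself); $\mathrm{des}(v,R)$ is the set of descendants of $v$; for $v$ not the root, $\mathrm{parent}(v,R)$ is the closest vertex to $v$ in $R$ that is not a descendant of $v$. A rooted tree on a totally ordered vertex set $V$ is increasing if $v\le w$ for all $v\in V$ and $w\in\mathrm{des}(v,R)$; its root is then necessarily the smallest element of $V$. $\mathrm{link}(v,S)$ is the set of all possible edges joining $v$ to an element of $S$. For a rooted tree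 $R$ on $V$ with root $r$ and $v\in V-\{r\}$, $J(v,R)=\mathrm{link}(\mathrm{parent}(v,R),\mathrm{des}(v,R))$. For a graph $G$ on $V$, $R$ is $G$-connected if $J(v,R)\cap G\neq\emptyset$ for every $v\in V-\{r\}$. (A $G$-connected tree need not be a subgraph of $G$.) For a connected graph $G$ on a totally ordered vertex set $V$, the increasing tree $k(G)$ on $V$, rooted at the smallest element of $V$, is defined by the following algorithm. Step 1: let $H$ be the empty (edgeless) graph on $V$ and set $S=V$. Step 2: let $r$ be the smallest vertex in $S$, and let $\pi$ be the depth-first partition of $G|_S$ rooted at $r$; add to $H$ the edges connecting $r$ to the smallest vertex of each block of $\pi$ (whether or not these are edges of $G$). Step 3: for each block $\pi_i$ of $\pi$ with more than one element, return to Step 2 with $S=\pi_i$. Step 4: return $k(G)=H$. *)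

(* Defs.v *)
From HB Require Import structures.
From mathcomp Require Import all_boot all_order.

Set Implicit Arguments.
Unset Strict Implicit.
Unset Printing Implicit Defensive.

Section Graphs.
Variable T : finType.

(* A graph is identified with its edge set; its vertex set V : {set T} is a
   separate argument wherever the edges alone do not determine the notion. *)
Definition graph := {set {set T}}.

Implicit Types (G : graph) (V S : {set T}) (v w x y r : T).

Definition is_graph V G : bool :=
  [forall e in G, (e \subset V) && (#|e| == 2)].

Definition adj G : rel T := fun x y => [set x; y] \in G.

Definition restr G S : graph := [set e in G | e \subset S].

(* x :: p is a (simple) path of G from x to y; its length is size p. *)
Definition gpath G x (p : seq T) y : bool :=
  [&& path (adj G) x p, uniq (x :: p) & last x p == y].

(* The partition s(G) of V, for a graph G on V. *)
Definition components V G : {set {set T}} :=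
  equivalence_partition (connect (adj G)) V.

Definition connected V G : Prop := {in V &, forall x y, connect (adj G) x y}.

Definition depth_first_partition V G r : {set {set T}} :=
  components (V :\ r) (restr G (V :\ r)).

Definition acyclic G : Prop :=
  forall c : seq T, 2 < size c -> ~ ucycle (adj G) c.

(* A simple path has fewer than #|T| edges, so quantifying over sequences of
   size at most #|T| loses nothing; when x and y are not joined by a path, the
   distance is the junk value #|T|. *)
Definition dist G x y : nat :=
  \big[minn/#|T|]_(p : #|T|.-bseq T | gpath G x p y) size p.

(* A rooted graph is the pair of its root and its edge set. *)
Definition rooted_graph := (T * graph)%type.

Implicit Type R : rooted_graph.

Definition rooted_tree V R : Prop :=
  [/\ R.1 \in V, is_graph V R.2, connected V R.2 & acyclic R.2].

Definition height R v : nat := dist R.2 R.1 v.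

Definition des v R : {set T} :=
  [set w | [exists p : #|T|.-bseq T,
     gpath R.2 v p w && sorted ltn [seq height R x | x <- v :: p]]].

(* Meaningful for v a non-root vertex; then the root is not a descendant of v,
   and the minimizer is unique. *)
Definition parent V v R : T :=
  [arg min_(u < R.1 | (u \in V) && (u \notin des v R)) dist R.2 v u].

Definition link v S : {set {set T}} := [set [set v; w] | w in S :\ v].

Definition J V v R : {set {set T}} := link (parent V v R) (des v R).

Definition tree_connected V G R : Prop :=
  {in V :\ R.1, forall v, J V v R :&: G != set0}.

End Graphs.

Section OrderedVertices.
Variables (disp : Order.disp_t) (T : finOrderType disp).

Implicit Types (G : graph T) (V S : {set T}) (R : rooted_graph T).

Definition is_smallest (x : T) S : bool :=
  (x \in S) && [forall y in S, (x <= y)%O].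

Definition increasing V R : Prop :=
  {in V, forall v, {in des v R, forall w, (v <= w)%O}}.

(* Steps 2 and 3 of the algorithm, started from the vertex set S: the edges
   added to H. The blocks are strictly smaller than S, so the recursion depth
   is at most #|S| and the fuel n = #|S| is never exhausted. *)
Fixpoint k_rec (n : nat) G S : graph T :=
  if n isn't n'.+1 then set0 else
  if [pick r | is_smallest r S] is Some r then
    let pi := depth_first_partition S (restr G S) r in
    [set [set r; m] | m in S & [exists B in pi, is_smallest m B]]
      :|: \bigcup_(B in pi | 1 < #|B|) k_rec n' G B
  else set0.

(* The edge set of k(G); its root is the smallest element of V. *)
Definition k V G : graph T := k_rec #|V| G V.

End OrderedVertices.

(* Main.v *)
Require Import Defs.
From HB Require Import structures.
From mathcomp Require Import all_boot all_order.

Set Implicit Arguments.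
Unset Strict Implicit.
Unset Printing Implicit Defensive.

(** Let v be a vertex of the increasing tree R. The subtrees at the children of
    v partition the proper descendants of v, and everything turns on comparing
    this partition with the depth-first partition at v of another graph.

    The definitions speak of R through distances and simple paths, so R is first
    brought to a usable form. Because R has no cycle, every non-root vertex has
    exactly one neighbour that is no higher than itself
    ([lower_neighbour_uniq]). This neighbour is the parent ([parentE]), every
    edge joins a vertex to its parent ([tree_edge]), and the descendants of v
    are what is reached from v by edges that go up ([in_des]).

    (3) implies (2): the edges of a union of sets E(v) join ancestors to
    descendants, hence none crosses between two subtrees at siblings, while the
    edge in J(c) ties the subtree at c to the parent of c. By induction all
    subtrees are connected, and the subtrees at the children of v are the
    depth-first partition at v ([ancestral_graph]). The tree R is itself such a
    graph, so the same lemma computes the depth-first partitions of R.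

    (2) implies (3): take E(v) to be the trace of G on J(v). An edge of G with
    both ends strictly above v lies inside one block at v; going down to the
    smallest subtree containing the edge puts it in some J(c) ([edge_in_J]).

    (2) implies (1): by recursion the algorithm, run on the descendants of v,
    joins v to the smallest vertex of each child subtree, that is, to the child,
    and then treats the subtrees ([k_rec_des]).

    (1) implies (2): for every connected G the graph built by the algorithm has
    the same depth-first partition as G at the smallest vertex
    ([k_rec_depth_first_partition]), and restricted to a block it is what the
    algorithm builds on that block ([k_rec_block]). With k(G) = R the blocks are
    the child subtrees, so the comparison descends along R ([k_rec_eq_tree]). *)

(** * Edges and restrictions *)

Section Graphs.
Variable T : finType.
Implicit Types (G H : graph T) (B S V W e : {set T}) (P : {set {set T}}).
Implicit Types (v w x y z : T) (R : rooted_graph T).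

Lemma eq_set2 x y z w :
  [set x; y] = [set z; w] -> (x = z /\ y = w) \/ (x = w /\ y = z).
Proof.
move=> E.
have: x \in [set z; w] by rewrite -E set21.
have: y \in [set z; w] by rewrite -E set22.
have: z \in [set x; y] by rewrite E set21.
have: w \in [set x; y] by rewrite E set22.
by do 4!case/set2P=> ?; subst; auto.
Qed.

Lemma adj_sym G : symmetric (adj G).
Proof. by move=> x y; rewrite /adj setUC. Qed.

Lemma connect_adj_sym G : connect_sym (adj G).
Proof. exact/sym_connect_sym/adj_sym. Qed.

Lemma sub_set2 x y S : ([set x; y] \subset S) = (x \in S) && (y \in S).
Proof. by rewrite subUset !sub1set. Qed.

Lemma in_restr G S e : (e \in restr G S) = (e \in G) && (e \subset S).
Proof. by rewrite inE. Qed.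

Lemma adj_restr G S x y :
  adj (restr G S) x y = [&& adj G x y, x \in S & y \in S].
Proof. by rewrite /adj in_restr sub_set2. Qed.

Lemma restr_restr G S W : W \subset S -> restr (restr G S) W = restr G W.
Proof.
move=> sWS; apply/setP=> e; rewrite !in_restr -andbA; congr (_ && _).
by apply: andb_idl => /subset_trans; apply.
Qed.

Lemma depth_first_partition_restr G S x :
  depth_first_partition S (restr G S) x = depth_first_partition S G x.
Proof. by rewrite /depth_first_partition restr_restr ?subsetDl. Qed.

Lemma restr_id V G : is_graph V G -> restr G V = G.
Proof.
move=> /forall_inP gG; apply/setP=> e; rewrite in_restr.
by apply: andb_idr => /gG /andP[].
Qed.

Lemma graph_edge V G e : is_graph V G -> e \in G ->
  exists x y, [/\ e = [set x; y], x != y, x \in V & y \in V].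
Proof.
move=> /forall_inP gG /gG /andP[eV /cards2P[x [y [xy Ee]]]].
by exists x, y; move: eV; rewrite Ee sub_set2 => /andP[].
Qed.

Lemma connect_adjS G H x y : G \subset H ->
  connect (adj G) x y -> connect (adj H) x y.
Proof.
move=> /subsetP sGH; apply: connect_sub => u v uv.
by apply: connect1; apply: sGH.
Qed.

Lemma restrS G S W : S \subset W -> restr G S \subset restr G W.
Proof.
move=> sSW; apply/subsetP=> e; rewrite !in_restr => /andP[-> /=].
by move=> /subset_trans; apply.
Qed.

(** * Components *)

Lemma components_partition V G : partition (components V G) V.
Proof.
apply: equivalence_partitionP => x y z _ _ _; split=> // xy.
exact: (same_connect (@connect_adj_sym G)).
Qed.

Lemma component_closed G W B x y : B \in components W (restr G W) ->
  [set x; y] \in G -> x \in B -> y \in W -> y \in B.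
Proof.
case/imsetP=> u uW -> xyG; rewrite !inE => /andP[xW ux] yW; rewrite yW.
by apply: connect_trans ux _; apply: connect1; rewrite adj_restr xW yW !andbT.
Qed.

(** A path that starts in a component cannot leave it, so it survives the
    restriction to that component. *)
Lemma component_connected G W B : B \in components W (restr G W) ->
  connected B (restr G B).
Proof.
move=> BC; have BW : B \subset W.
  have /and3P[/eqP <- _ _] := components_partition W (restr G W).
  exact: bigcup_sup.
have stay x y : x \in B -> connect (adj (restr G W)) x y ->
    connect (adj (restr G B)) x y.
  move=> xB /connectP[p]; elim: p x xB => [|z p IHp] x xB /=; first by move=> _ ->.
  rewrite adj_restr -!andbA => /and4P[xz _ zW pp] Ey.
  have zB : z \in B by apply: component_closed BC xz xB zW.
  apply: connect_trans (IHp _ zB pp Ey); apply: connect1.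
  by rewrite adj_restr xB zB !andbT.
move=> x y xB yB; apply: stay => //.
case/imsetP: BC xB yB => u _ ->; rewrite !inE => /andP[_ ux] /andP[_ uy].
by apply: connect_trans uy; rewrite connect_adj_sym.
Qed.

(** The only way in which components are computed below: it suffices that the
    blocks are connected and that no edge leaves a block. *)
Lemma components_eq W H P : partition P W ->
    {in P, forall B, connected B (restr H B)} ->
    (forall B x y, B \in P -> [set x; y] \in H -> x \in B -> y \in W -> y \in B) ->
  components W (restr H W) = P.
Proof.
move=> partP connP closP; rewrite -[RHS](equivalence_partition_pblock partP).
have [/eqP covP trivP _] := and3P partP.
apply: eq_in_imset => x xW; apply/setP=> y; rewrite !inE.
have xP : x \in cover P by rewrite covP.
have BP := pblock_mem xP; have xB : x \in pblock P x by rewrite mem_pblock.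
move: (pblock P x) BP xB => B BP xB.
apply: andb_id2l => yW; apply/idP/idP => [/connectP[p]|yB].
  elim: p (x) {yW} xB xW => [|z p IHp] u uB uW /=; first by move=> _ ->.
  rewrite adj_restr -!andbA => /and4P[uz _ zW pp] Ey.
  exact: IHp (closP _ _ _ BP uz uB zW) zW pp Ey.
apply: connect_adjS (connP _ BP _ _ xB yB).
by apply: restrS; rewrite -covP; apply: bigcup_sup.
Qed.

(** The gluing step by which both the subtrees of R and the output of the
    algorithm are shown connected. *)
Lemma star_connected S x P H : x \in S -> partition P (S :\ x) ->
    {in P, forall B, connected B (restr H B)} ->
    {in P, forall B, exists2 y, y \in B & [set x; y] \in H} ->
  connected S (restr H S).
Proof.
move=> xS partP connP linkP; have [/eqP covP _ _] := and3P partP.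
suff cx y : y \in S -> connect (adj (restr H S)) x y.
  by move=> y z yS zS; apply: connect_trans (cx z zS); rewrite connect_adj_sym cx.
move=> yS; have [-> // | yx] := eqVneq y x.
have: y \in cover P by rewrite covP !inE yx.
case/bigcupP=> B BP yB; have [z zB xz] := linkP B BP.
have sBS : B \subset S.
  by apply: subset_trans (subD1set S x); rewrite -covP; apply: bigcup_sup.
apply: (@connect_trans _ _ z).
  by apply: connect1; rewrite adj_restr xS (subsetP sBS) ?andbT.
exact: connect_adjS (restrS _ sBS) (connP _ BP _ _ zB yB).
Qed.

(** * Distances *)

Lemma size_gpath G x p y : gpath G x p y -> size p < #|T|.
Proof.
case/and3P=> _ Up _; rewrite -[(size p).+1]/(size (x :: p)) -(card_uniqP Up).
exact: max_card.
Qed.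

(** Shortening a walk to a simple path makes the bound available for walks. *)
Lemma dist_path G x p : path (adj G) x p -> dist G x (last x p) <= size p.
Proof.
case/shortenP=> q xq Uq /uniq_leq_size qp.
have gq : gpath G x q (last x q) by rewrite /gpath xq Uq /=.
apply: leq_trans (qp _); last by case/andP: Uq.
have szq := ltnW (size_gpath gq).
rewrite /dist -minEnat -leEnat.
exact: (@Order.TotalTheory.bigmin_le_cond _ nat _ _ (Bseq szq)).
Qed.

Lemma dist_attained G x y : connect (adj G) x y ->
  exists2 p, path (adj G) x p & last x p = y /\ size p = dist G x y.
Proof.
case/connectP=> p0 /shortenP[p xp Up _] ->.
have gp : gpath G x p (last x p) by rewrite /gpath xp Up /=.
have szp := ltnW (size_gpath gp); rewrite /dist -minEnat.
have [|q /and3P[xq _ /eqP Eq] ->] := @Order.TotalTheory.eq_bigmin _ nat _ #|T|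
    (Bseq szp) (fun q : #|T|.-bseq T => gpath G x q (last x p)) (fun q => size q) gp.
  by move=> q _; rewrite leEnat size_bseq.
by exists q.
Qed.

(** * Rooted trees *)

Definition up R : rel T :=
  [rel x y | adj R.2 x y && (height R x < height R y)].

(** Strictly increasing heights make a walk simple, so that descent is plain
    reachability along edges that go up. *)
Lemma in_des R v w : (w \in des v R) = connect (up R) v w.
Proof.
have upP p : path (up R) v p =
    path (adj R.2) v p && sorted ltn [seq height R x | x <- v :: p].
  rewrite /= path_map; elim: p v => //= y p IHp v; rewrite IHp /=.
  by rewrite -!andbA; do !bool_congr.
rewrite inE; apply/existsP/connectP => [[p]|[p]].
  by case/andP=> /and3P[vp _ /eqP <-] sp; exists p; rewrite // upP vp.
rewrite upP => /andP[vp sp] Ew.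
have Up : uniq (v :: p).
  apply: (@map_uniq _ _ (height R)).
  by apply: sorted_uniq sp; [apply: ltn_trans | apply: ltnn].
have gp : gpath R.2 v p w by rewrite /gpath vp Up Ew /=.
by exists (Bseq (ltnW (size_gpath gp))); rewrite gp.
Qed.

Lemma des_refl R v : v \in des v R.
Proof. by rewrite in_des. Qed.

Lemma des_trans R u v w : u \in des v R -> w \in des u R -> w \in des v R.
Proof. by rewrite !in_des; apply: connect_trans. Qed.

Lemma des_height R v w : w \in des v R -> w = v \/ height R v < height R w.
Proof.
rewrite in_des => /connectP[p]; elim: p v => [|u p IHp] v /=; first by left.
case/andP=> /andP[_ vu] /IHp{}IHp /IHp[-> | uw]; right=> //.
exact: ltn_trans uw.
Qed.

Section RootedTree.
Variables (V : {set T}) (R : rooted_graph T).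
Hypothesis treeR : rooted_tree V R.

Let h := height R.
Let par v := parent V v R.

Let root_in : R.1 \in V. Proof. by case: treeR. Qed.
Let graphR : is_graph V R.2. Proof. by case: treeR. Qed.

Lemma tree_adj x y : adj R.2 x y -> [/\ x != y, x \in V & y \in V].
Proof.
case/(graph_edge graphR)=> u [v [/eq_set2[[-> ->]|[-> ->]]]] uv uV vV //.
by rewrite eq_sym.
Qed.

Lemma height_path v : v \in V ->
  exists2 p, path (adj R.2) R.1 p & last R.1 p = v /\ size p = h v.
Proof. by move=> vV; apply: dist_attained; case: treeR => _ _ cR _; apply: cR. Qed.

Lemma height_gt0 v : v \in V -> v != R.1 -> 0 < h v.
Proof.
by move=> vV; case: (height_path vV) => -[|x p] _ [<- <-] //=; rewrite eqxx.
Qed.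

Lemma height_root : h R.1 = 0.
Proof.
apply/eqP; rewrite -leqn0.
exact: (@dist_path R.2 R.1 [::] isT).
Qed.

(** The last step of a shortest path from the root. *)
Lemma lower_neighbour v : v \in V -> v != R.1 -> exists u, up R u v.
Proof.
move=> vV vr; have [p] := height_path vV.
case/lastP: p => [_ [] Ev|p x]; first by rewrite -Ev eqxx in vr.
rewrite rcons_path last_rcons size_rcons => /andP[rp px] [Ex hv].
exists (last R.1 p); rewrite /up /= -Ex px /= Ex -/(h v) -hv ltnS.
exact: dist_path.
Qed.

(** A shortest path from the root to u cannot pass through a vertex v at least
    as far from the root as u. *)
Lemma connect_avoiding u v : adj R.2 u v -> h u <= h v ->
  connect (adj (restr R.2 (~: [set v]))) R.1 u.
Proof.
move=> uv huv; have [uNv uV _] := tree_adj uv.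
have [p rp [Eu szp]] := height_path uV.
have vp : v \notin R.1 :: p.
  rewrite inE negb_or; apply/andP; split.
    apply: contra uNv => /eqP Ev; move: huv; rewrite Ev height_root leqn0.
    by apply: contraTT => /(height_gt0 uV); rewrite lt0n.
  apply/negP=> vp; case/splitPr: vp rp Eu szp => p1 p2.
  rewrite -cat_rcons cat_path last_cat size_cat last_rcons => /andP[rp1 _] Eu szp.
  have := dist_path rp1; rewrite last_rcons -[dist _ _ _]/(h v) => hv.
  (* The part of the path up to v is already as long as the whole path. *)
  have: size (rcons p1 v) + size p2 <= size (rcons p1 v).
    by rewrite szp (leq_trans huv).
  rewrite -{2}[size (rcons _ _)]addn0 leq_add2l leqn0 => /nilP p2nil.
  by move: uNv; rewrite -Eu p2nil eqxx.
apply/connectP; exists p => //; clear Eu szp.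
elim: p (R.1) rp vp => //= x p IHp z /andP[zx xp].
rewrite !inE !negb_or => /and3P[zv xv vp].
by rewrite adj_restr zx !inE ![_ == v]eq_sym zv xv IHp // inE negb_or xv.
Qed.

(** Two distinct neighbours no higher than v would be joined by a path avoiding v, and v
    would close it into a cycle. *)
Lemma lower_neighbour_uniq u u' v :
  adj R.2 u v -> adj R.2 u' v -> h u <= h v -> h u' <= h v -> u = u'.
Proof.
move=> uv u'v hu hu'; apply/eqP/negPn/negP=> uu'.
have := connect_avoiding uv hu; rewrite connect_adj_sym => cu.
have cuu' := connect_trans cu (connect_avoiding u'v hu').
have /connectP[p0 /shortenP[p up Up _] Eu'] := cuu'.
have [_ _ _ acR] := treeR; apply: (acR (v :: u :: p)).
  by case: p Eu' {up Up} => //= Eu'; rewrite Eu' eqxx in uu'.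
have [uNv _ _] := tree_adj uv.
apply/andP; split; last first.
  rewrite cons_uniq Up andbT inE negb_or eq_sym uNv /=.
  elim: p (u) up {Up Eu'} => //= x p IHp z.
  by rewrite adj_restr !inE => /andP[/and3P[_ _ xv] /IHp vp]; rewrite negb_or eq_sym xv.
rewrite /cycle rcons_cons /= adj_sym uv rcons_path -Eu' u'v andbT.
by apply: sub_path up => x y; rewrite adj_restr => /andP[].
Qed.

(** By uniqueness, all other neighbours of v are higher than v, hence are
    descendants; so the lower one is the vertex outside des(v) nearest to v. *)
Lemma parentE u v : up R u v -> par v = u.
Proof.
case/andP=> uv hu; have [uNv uV vV] := tree_adj uv.
have vr : v != R.1 by apply: contraTneq hu => ->; rewrite [height R R.1]height_root.
have NdesR : R.1 \notin des v R.
  apply/negP=> /des_height[/eqP|]; first by rewrite eq_sym (negPf vr).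
  by rewrite [height R R.1]height_root.
have Ndesu : u \notin des v R.
  by apply/negP=> /des_height[/eqP | /ltn_trans/(_ hu)]; rewrite ?(negPf uNv) ?ltnn.
rewrite /par /parent; case: arg_minnP => [|w /andP[wV wdes] /(_ u)].
  by rewrite root_in.
rewrite uV Ndesu => /(_ isT).
have: dist R.2 v u <= 1 by apply: (@dist_path R.2 v [:: u]); rewrite /= adj_sym uv.
have [_ _ cR _] := treeR.
have [[|x [|y p]] vp [/= Ew <-]] := dist_attained (cR v w vV wV).
- by rewrite Ew des_refl in wdes.
- move=> _ _; move: vp; rewrite /= andbT Ew => vw.
  apply: lower_neighbour_uniq uv _ (ltnW hu); first by rewrite adj_sym.
  rewrite leqNgt; apply: contra wdes => hvw.
  by rewrite in_des; apply: connect1; rewrite /up /= vw.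
- by move=> d1 /leq_trans/(_ d1).
Qed.

Lemma up_parent v : v \in V :\ R.1 -> up R (par v) v.
Proof.
by case/setD1P=> vr vV; have [u uv] := lower_neighbour vV vr; rewrite (parentE uv).
Qed.

Lemma parent_in v : v \in V :\ R.1 -> par v \in V.
Proof. by move/up_parent/andP=> [/tree_adj[]]. Qed.

Lemma height_parent v : v \in V :\ R.1 -> h (par v) < h v.
Proof. by move/up_parent/andP=> []. Qed.

Lemma up_nonroot u v : up R u v -> v \in V :\ R.1.
Proof.
case/andP=> /tree_adj[_ _ vV] hu; rewrite !inE vV andbT.
by apply: contraTneq hu => ->; rewrite [height R R.1]height_root.
Qed.

(** The ends x, y of an edge are never level: otherwise y would have two
    neighbours no higher than itself, x and the one below. *)
Lemma tree_edge e : e \in R.2 -> exists2 c, c \in V :\ R.1 & e = [set par c; c].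
Proof.
move=> eR; have [x [y [Ee xy xV yV]]] := graph_edge graphR eR.
have xyR : adj R.2 x y by rewrite /adj -Ee.
have [hxy|hyx|hxy] := ltngtP (h x) (h y).
- have uxy : up R x y by rewrite /up /= xyR.
  by exists y; rewrite ?(up_nonroot uxy) // (parentE uxy).
- have uyx : up R y x by rewrite /up /= adj_sym xyR.
  by exists x; rewrite ?(up_nonroot uyx) // (parentE uyx) setUC.
have yr : y != R.1.
  apply: contraNneq xy => Ey; move: hxy; rewrite Ey height_root => hx.
  by apply: contraTT (leqnn 0) => /(height_gt0 xV); rewrite hx.
have [u /andP[uy hu]] := lower_neighbour yV yr.
have Eu : u = x by apply: lower_neighbour_uniq uy xyR (ltnW hu) _; rewrite hxy.
by move: hu; rewrite Eu -/(h x) -/(h y) hxy ltnn.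
Qed.

Lemma edge_parent c : c \in V :\ R.1 -> [set par c; c] \in R.2.
Proof. by case/up_parent/andP. Qed.

Lemma in_des_parent v w : w \in des v R -> w != v ->
  w \in V :\ R.1 /\ par w \in des v R.
Proof.
rewrite in_des => /connectP[p]; case/lastP: p => [_ ->|p x]; first by rewrite eqxx.
rewrite last_rcons rcons_path => /andP[vp px] -> _.
rewrite (up_nonroot px) (parentE px) in_des; split=> //.
by apply/connectP; exists p.
Qed.

Lemma des_parent w : w \in V :\ R.1 -> w \in des (par w) R.
Proof. by move=> wV; rewrite in_des connect1 ?up_parent. Qed.

Lemma des_sub v : v \in V -> des v R \subset V.
Proof.
move=> vV; apply/subsetP=> w wv; have [-> // | wNv] := eqVneq w v.
by have [/setD1P[]] := in_des_parent wv wNv.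
Qed.

Lemma des_root : des R.1 R = V.
Proof.
apply/eqP; rewrite eqEsubset des_sub //=; apply/subsetP=> w.
elim: {w}(h w) {-2}w (leqnn (h w)) => [|n IHn] w hw wV.
all: have [-> | wr] := eqVneq w R.1; rewrite ?des_refl //.
  by move: (height_gt0 wV wr); rewrite ltnNge hw.
have wVr : w \in V :\ R.1 by rewrite !inE wr.
apply: des_trans (des_parent wVr); apply: IHn (parent_in wVr).
by rewrite -ltnS (leq_trans (height_parent wVr)).
Qed.

(** * Subtrees at the children of a vertex *)

Definition children v : {set T} := [set c in V :\ R.1 | par c == v].

Definition child_blocks v : {set {set T}} := [set des c R | c in children v].

Lemma childP v c : reflect (c \in V :\ R.1 /\ par c = v) (c \in children v).
Proof.
rewrite /children inE.
by apply: (iffP andP) => -[cV /eqP cv].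
Qed.

Lemma child_des v c : c \in children v -> c \in des v R.
Proof. by case/childP=> cV <-; apply: des_parent. Qed.

Lemma child_notin v c : c \in children v -> v \notin des c R.
Proof.
case/childP=> cV <-; have hc := height_parent cV.
apply/negP=> /des_height[E | hc']; first by rewrite E ltnn in hc.
by have := ltn_trans hc hc'; rewrite ltnn.
Qed.

Lemma des_child_sub v c : c \in children v -> des c R \subset des v R :\ v.
Proof.
move=> cv; apply/subsetP=> w wc; rewrite in_setD1 (des_trans (child_des cv) wc) andbT.
by apply: contraNneq (child_notin cv) => <-.
Qed.

Lemma des_childP v w : w \in des v R -> w != v ->
  exists2 c, c \in children v & w \in des c R.
Proof.
elim: {w}(h w) {-2}w (leqnn (h w)) => [|n IHn] w hw wv wNv.
all: have [wV pv] := in_des_parent wv wNv; have hp := height_parent wV.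
  by move: (leq_trans hp hw).
have [pE | pNv] := eqVneq (par w) v.
  by exists w; rewrite ?des_refl // inE wV pE /=.
have [|c cv pc] := IHn _ _ pv pNv; first by rewrite -ltnS (leq_trans hp).
by exists c; rewrite // (des_trans pc) // des_parent.
Qed.

(** The parent of a common descendant is again a common descendant, until one
    of the two siblings is reached; but no sibling lies above the other. *)
Lemma child_disjoint v c c' w : c \in children v -> c' \in children v ->
  w \in des c R -> w \in des c' R -> c = c'.
Proof.
move=> cv c'v.
have Nup x y :
    x \in children v -> y \in children v -> x \in des y R -> x = y.
  move=> xv yv xy; apply/eqP; apply: contraNT (child_notin yv) => xNy.
  by have [_] := in_des_parent xy xNy; case/childP: xv => _ ->.
elim: {w}(h w) {-2}w (leqnn (h w)) => [|n IHn] w hw wc wc'.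
all: have [Ew | wNc] := eqVneq w c; first by rewrite Ew in wc'; apply: Nup.
all: have [Ew | wNc'] := eqVneq w c'; first by rewrite Ew in wc; apply/esym/Nup.
all: have [wV pc] := in_des_parent wc wNc; have hp := height_parent wV.
  by move: (leq_trans hp hw).
have [_ pc'] := in_des_parent wc' wNc'.
by apply: IHn pc pc'; rewrite -ltnS (leq_trans hp).
Qed.

Lemma child_blocks_partition v : partition (child_blocks v) (des v R :\ v).
Proof.
apply/and3P; split.
- rewrite eqEsubset; apply/andP; split.
    by apply/bigcupsP=> B /imsetP[c cv ->]; apply: des_child_sub.
  apply/subsetP=> w /setD1P[wNv wv]; have [c cv wc] := des_childP wv wNv.
  by apply/bigcupP; exists (des c R) => //; apply/imsetP; exists c.
- apply/trivIsetP=> _ _ /imsetP[c cv ->] /imsetP[c' c'v ->] cc'.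
  rewrite -setI_eq0; apply/set0Pn=> -[w /setIP[wc wc']].
  by case/eqP: cc'; rewrite (child_disjoint cv c'v wc wc').
by apply/imsetP=> -[c _ E]; have := des_refl R c; rewrite -E in_set0.
Qed.

Lemma mem_child_blocks v c : c \in children v -> des c R \in child_blocks v.
Proof. by move=> cv; apply/imsetP; exists c. Qed.

Lemma card_des_child v c : c \in children v -> #|des c R| < #|des v R|.
Proof.
move=> cv; apply: leq_ltn_trans (subset_leq_card (des_child_sub cv)) _.
by rewrite [X in _ < X](cardsD1 v) des_refl.
Qed.

Lemma child_parent c : c \in V :\ R.1 -> c \in children (par c).
Proof. by move=> cV; apply/childP. Qed.

Lemma mem_J c w : c \in V :\ R.1 -> w \in des c R -> [set par c; w] \in J V c R.
Proof.
move=> cV wc; apply/imsetP; exists w => //; rewrite in_setD1 wc andbT.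
by apply: contraNneq (child_notin (child_parent cV)) => Ew; rewrite Ew in wc.
Qed.

Lemma JP c e : e \in J V c R -> exists2 w, w \in des c R & e = [set par c; w].
Proof. by case/imsetP=> w /setD1P[_ wc] ->; exists w. Qed.

(** If every edge of H joins an ancestor to a descendant, no edge of H crosses
    between the subtrees at two children of v; if moreover H meets each J(c),
    then the subtree at c is tied to its parent, so by induction every subtree
    is connected in H. *)
Lemma ancestral_graph H v : tree_connected V H R ->
    (forall e, e \in H -> exists2 c, c \in V :\ R.1 & e \in J V c R) ->
    v \in V ->
  connected (des v R) (restr H (des v R)) /\
  depth_first_partition (des v R) H v = child_blocks v.
Proof.
move=> conH subH; elim: {v}#|_| {-2}v (leqnn #|des v R|) => [|n IHn] v lev vV.
  move: lev; rewrite leqn0 cards_eq0 => /eqP E.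
  by have := des_refl R v; rewrite E in_set0.
have connC : {in child_blocks v, forall B, connected B (restr H B)}.
  move=> _ /imsetP[c cv ->]; have [cV _] := childP _ _ cv.
  have [] // := IHn c; first by rewrite -ltnS (leq_trans (card_des_child cv)).
  by case/setD1P: cV.
have partC := child_blocks_partition v; split.
  apply: star_connected (des_refl R v) partC connC _ => _ /imsetP[c cv ->].
  have [cV Ev] := childP _ _ cv.
  have /set0Pn[e /setIP[/JP[w wc Ee] eH]] := conH c cV.
  by exists w; rewrite // -Ev -/(par c) -Ee.
apply: components_eq partC connC _ => _ x y /imsetP[c cv ->] xyH xc /setD1P[yNv yv].
have [d dV /JP[z zd /eq_set2[[Ex Ey]|[Ex Ey]]]] := subH _ xyH.
all: have zp := des_trans (des_parent dV) zd.
  by rewrite Ey; apply: des_trans xc _; rewrite Ex.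
(* Here y is an ancestor of x, so the child c' with y in its subtree also has x there. *)
have [c' c'v yc'] := des_childP yv yNv.
rewrite (child_disjoint cv c'v xc) //; apply: des_trans yc' _.
by rewrite Ex Ey.
Qed.

Lemma tree_depth_first_partition v : v \in V ->
  depth_first_partition (des v R) R.2 v = child_blocks v.
Proof.
move=> vV; apply: (proj2 (ancestral_graph _ _ vV)) => [c cV|e /tree_edge[c cV ->]].
  apply/set0Pn; exists [set par c; c].
  by rewrite inE mem_J ?des_refl ?edge_parent.
by exists c; rewrite // mem_J ?des_refl.
Qed.

(** For an edge xy of G take the smallest subtree containing both ends, at v
    say. If v is neither x nor y, then x and y lie in one block of the
    depth-first partition at v, that is, in a smaller subtree. *)
Lemma edge_in_J G e : is_graph V G ->
    {in V, forall v, depth_first_partition (des v R) G v = child_blocks v} ->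
  e \in G -> exists2 c, c \in V :\ R.1 & e \in J V c R.
Proof.
move=> gG dfpG eG; have [x [y [Ee xy xV yV]]] := graph_edge gG eG.
have rP : (R.1 \in V) && (e \subset des R.1 R).
  by rewrite des_root Ee sub_set2 root_in xV.
case: (arg_minnP (P := fun v => (v \in V) && (e \subset des v R))
         (fun v => #|des v R|) rP).
move=> v /andP[vV]; rewrite Ee sub_set2 => /andP[xv yv] minv.
have end_at z : z \in des v R -> z != v ->
    exists2 c, c \in V :\ R.1 & [set v; z] \in J V c R.
  move=> zv zNv; have [c cv zc] := des_childP zv zNv.
  by have [cV <-] := childP _ _ cv; exists c; rewrite ?mem_J.
have [Ex | xNv] := eqVneq x v.
  by rewrite Ex; apply: end_at; rewrite // -Ex eq_sym.
have [Ey | yNv] := eqVneq y v; first by rewrite Ey setUC; apply: end_at.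
have [c cv xc] := des_childP xv xNv.
have yc : y \in des c R.
  apply: (@component_closed G (des v R :\ v) _ x) => //.
  - rewrite -[components _ _]/(depth_first_partition _ _ _) dfpG //.
    exact: mem_child_blocks.
  - by rewrite -Ee.
  - by rewrite in_setD1 yNv.
have cV : c \in V by have [/setD1P[]] := childP _ _ cv.
by have := minv c; rewrite cV sub_set2 xc yc leqNgt card_des_child // => /(_ isT).
Qed.

End RootedTree.
End Graphs.

(** * The algorithm *)

Section Ordered.
Variables (disp : Order.disp_t) (T : finOrderType disp).
Implicit Types (G : graph T) (V S B e : {set T}) (R : rooted_graph T) (r m : T).

Lemma smallest_in r S : is_smallest r S -> r \in S.
Proof. by case/andP. Qed.

Lemma smallest_uniq r m S : is_smallest r S -> is_smallest m S -> r = m.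
Proof.
case/andP=> rS /forall_inP rP /andP[mS /forall_inP mP].
by apply/Order.POrderTheory.le_anti; rewrite rP ?mP.
Qed.

Lemma smallest_exists S : S != set0 -> exists r, is_smallest r S.
Proof.
case/set0Pn=> x xS.
case: (@Order.TotalTheory.arg_minP _ T _ x (mem S) id xS) => r rS minr.
by exists r; apply/andP; split=> //; apply/forall_inP.
Qed.

Lemma block_smallest S G r B : B \in depth_first_partition S G r ->
  exists m, is_smallest m B.
Proof.
move=> BP; apply: smallest_exists; apply: contraTneq BP => ->.
by case/and3P: (components_partition (S :\ r) (restr G (S :\ r))).
Qed.

Lemma block_sub S G r B : B \in depth_first_partition S G r -> B \subset S :\ r.
Proof.
move=> BP.
have /and3P[/eqP <- _ _] := components_partition (S :\ r) (restr G (S :\ r)).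
exact: bigcup_sup.
Qed.

Lemma card_block n S G r B : #|S| <= n.+1 -> r \in S ->
  B \in depth_first_partition S G r -> #|B| <= n.
Proof.
move=> cS rS /block_sub/subset_leq_card cB; apply: leq_trans cB _.
by rewrite (cardsD1 r) rS in cS.
Qed.

(** The algorithm skips the blocks with one element; as running it there would
    add nothing, [k_recP] can treat all blocks alike. *)
Lemma k_rec_small n G S : #|S| <= 1 -> k_rec n G S = set0.
Proof.
case: n => //= n cS; case: pickP => // r /smallest_in rS.
have P0 : depth_first_partition S (restr G S) r = set0.
  rewrite /depth_first_partition /components /equivalence_partition.
  suff -> : S :\ r = set0 by rewrite imset0.
  by apply/eqP; rewrite -cards_eq0; move: cS; rewrite (cardsD1 r S) rS; case: #|_|.
rewrite P0 big1 => [|B /andP[]]; last by rewrite inE.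
rewrite setU0; apply/setP=> e; rewrite inE; apply/imsetP=> -[m].
by rewrite inE => /andP[_ /exists_inP[B]]; rewrite inE.
Qed.

Lemma k_recP n G S r e : is_smallest r S ->
  e \in k_rec n.+1 G S <->
  exists2 B, B \in depth_first_partition S G r &
    (exists2 m, is_smallest m B & e = [set r; m]) \/ e \in k_rec n G B.
Proof.
move=> rS /=; case: pickP => [x /smallest_uniq/(_ rS) -> | /(_ r)]; last by rewrite rS.
rewrite depth_first_partition_restr; split.
  case/setUP=> [/imsetP[m] | /bigcupP[B /andP[BP _] eB]]; last by exists B; auto.
  by rewrite inE => /andP[_ /exists_inP[B BP mB]] ->; exists B => //; left; exists m.
case=> B BP [[m mB ->] | eB]; apply/setUP; [left | right].
  apply/imsetP; exists m => //; rewrite inE; apply/andP; split.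
    by have /subsetP/(_ m (smallest_in mB))/setD1P[] := block_sub BP.
  by apply/exists_inP; exists B.
apply/bigcupP; exists B; rewrite // BP ltnNge /=.
by apply: contraTN eB => /k_rec_small ->; rewrite inE.
Qed.

Lemma k_rec_sub n G S e : e \in k_rec n G S -> e \subset S.
Proof.
elim: n S => [|n IHn] S; first by rewrite inE.
have [->|/smallest_exists[r rS]] := eqVneq S set0.
  by rewrite k_rec_small ?cards0 ?inE.
case/(k_recP _ _ _ rS)=> B /block_sub BS; have {}BS := subset_trans BS (subD1set S r).
case=> [[m mB ->] | /IHn/subset_trans]; last by apply.
by rewrite sub_set2 (smallest_in rS) (subsetP BS) ?smallest_in.
Qed.

(** The algorithm joins r to every block, even to one into which r has no edge
    of G; the blocks are connected by recursion. *)
Lemma k_rec_connected n G S : #|S| <= n -> connected S (restr (k_rec n G S) S).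
Proof.
elim: n S => [|n IHn] S cS.
  by move=> x y; move: cS; rewrite leqn0 cards_eq0 => /eqP ->; rewrite inE.
have [->|/smallest_exists[r rS]] := eqVneq S set0.
  by move=> x y; rewrite inE.
have rinS := smallest_in rS.
have partS := components_partition (S :\ r) (restr G (S :\ r)).
apply: star_connected (rinS) partS _ _ => B BP.
  move=> x y xB yB; apply: connect_adjS (IHn B (card_block cS rinS BP) x y xB yB).
  apply/subsetP=> e; rewrite !in_restr => /andP[eB ->]; rewrite andbT.
  by apply/(k_recP _ _ _ rS); exists B; auto.
have [m mB] := block_smallest BP; exists m; first exact: smallest_in.
by apply/(k_recP _ _ _ rS); exists B => //; left; exists m.
Qed.

Lemma k_rec_neq0 n G S e : e \in k_rec n G S -> e != set0.
Proof.
elim: n S => [|n IHn] S; first by rewrite inE.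
have [->|/smallest_exists[r rS]] := eqVneq S set0.
  by rewrite k_rec_small ?cards0 ?inE.
case/(k_recP _ _ _ rS)=> B _ [[m _ ->] | /IHn //].
by apply/set0Pn; exists r; rewrite set21.
Qed.

Lemma block_uniq S G r B B' x : B \in depth_first_partition S G r ->
  B' \in depth_first_partition S G r -> x \in B -> x \in B' -> B = B'.
Proof.
case/and3P: (components_partition (S :\ r) (restr G (S :\ r))) => _ trivP _.
by move=> BP B'P xB xB'; rewrite -(def_pblock trivP BP xB) (def_pblock trivP B'P xB').
Qed.

Lemma root_notin_block S G r B : B \in depth_first_partition S G r -> r \notin B.
Proof. by move/block_sub/subsetP=> BS; apply/negP=> /BS; rewrite !inE eqxx. Qed.

Lemma k_rec_block n G S r B : is_smallest r S -> B \in depth_first_partition S G r ->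
  restr (k_rec n.+1 G S) B = k_rec n G B.
Proof.
move=> rS BP; apply/setP=> e; rewrite in_restr; apply/andP/idP => [[]|eB]; last first.
  by split; [apply/(k_recP _ _ _ rS); exists B; auto | apply: k_rec_sub eB].
case/(k_recP _ _ _ rS)=> B' B'P [[m _ ->] | eB'] eB.
  by move: eB; rewrite sub_set2 (negPf (root_notin_block BP)).
have /set0Pn[x xe] := k_rec_neq0 eB'.
by rewrite (block_uniq BP B'P (subsetP eB x xe)) // (subsetP (k_rec_sub eB')).
Qed.

(** The algorithm preserves depth-first partitions: the edges it adds avoiding
    r stay inside blocks, and they connect each block. *)
Lemma k_rec_depth_first_partition n G S r : #|S| <= n.+1 -> is_smallest r S ->
  depth_first_partition S (k_rec n.+1 G S) r = depth_first_partition S G r.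
Proof.
move=> cS rS; have rinS := smallest_in rS.
apply: components_eq; first exact: components_partition.
  move=> B BP; have := @k_rec_connected n G B (card_block cS rinS BP).
  by rewrite -(k_rec_block n rS BP) restr_restr.
move=> B x y BP /(k_recP _ _ _ rS)[B' B'P [[m _ E] | eB']] xB /setD1P[yr _].
  have: r \in [set x; y] by rewrite E set21.
  case/set2P=> Er; last by rewrite Er eqxx in yr.
  by rewrite -Er (negPf (root_notin_block BP)) in xB.
move: (k_rec_sub eB'); rewrite sub_set2 => /andP[xB' yB'].
by rewrite (block_uniq BP B'P xB xB').
Qed.

Section IncreasingTree.
Variables (V : {set T}) (R : rooted_graph T).
Hypotheses (treeR : rooted_tree V R) (incR : increasing V R).

Lemma smallest_des v : v \in V -> is_smallest v (des v R).
Proof.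
by move=> vV; rewrite /is_smallest des_refl; apply/forall_inP=> w; apply: incR.
Qed.

(** Going down the tree: the first step of the algorithm on des(v) leaves the
    subtrees at the children of v as blocks, and the restriction of its output
    to such a block is its output on that block. *)
Lemma k_rec_eq_tree n G v : v \in V -> #|des v R| <= n ->
    connected (des v R) (restr G (des v R)) ->
    k_rec n G (des v R) = restr R.2 (des v R) ->
  {in des v R, forall w, connected (des w R) (restr G (des w R)) /\
    depth_first_partition (des w R) G w = depth_first_partition (des w R) R.2 w}.
Proof.
elim: n v => [|n IHn] v vV.
  by rewrite leqn0 cards_eq0 => /eqP E; have := des_refl R v; rewrite E in_set0.
move=> cv conn kE; have vS := smallest_des vV.
have dfpE : depth_first_partition (des v R) G v = depth_first_partition (des v R) R.2 v.
  by rewrite -(k_rec_depth_first_partition G cv vS) kE depth_first_partition_restr.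
move=> w wv; have [-> // | wNv] := eqVneq w v.
have [c cv' wc] := des_childP treeR wv wNv.
have [/setD1P[_ cV] _] := childP _ _ _ _ cv'.
have cB : des c R \in depth_first_partition (des v R) G v.
  by rewrite dfpE (tree_depth_first_partition treeR) // mem_child_blocks.
apply: IHn wc => //; first exact: card_block cv (des_refl R v) cB.
  exact: component_connected cB.
rewrite -(k_rec_block n vS cB) kE restr_restr //.
exact: subset_trans (block_sub cB) (subD1set _ _).
Qed.

(** Conversely, when the blocks are the subtrees at the children of v, the
    smallest vertex of a block is the child itself. *)
Lemma k_rec_des n G v :
    {in V, forall u, depth_first_partition (des u R) G u = child_blocks V R u} ->
  v \in V -> #|des v R| <= n -> k_rec n G (des v R) = restr R.2 (des v R).
Proof.
move=> dfpG; elim: n v => [|n IHn] v vV.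
  by rewrite leqn0 cards_eq0 => /eqP E; have := des_refl R v; rewrite E in_set0.
move=> cardv; have vS := smallest_des vV.
have IHc c : c \in children V R v -> k_rec n G (des c R) = restr R.2 (des c R).
  move=> cv; have [/setD1P[_ cV] _] := childP _ _ _ _ cv; apply: IHn => //.
  by rewrite -ltnS (leq_trans (card_des_child treeR cv)).
apply/setP=> e; rewrite in_restr; apply/idP/andP.
  case/(k_recP _ _ _ vS)=> B; rewrite dfpG // => /imsetP[c cv ->].
  have [cV Ev] := childP _ _ _ _ cv; have cdes := child_des treeR cv.
  case=> [[m mB ->] | ]; last first.
    rewrite IHc // => ecR; apply/andP; rewrite -in_restr; apply: subsetP ecR.
    by apply/restrS/(subset_trans (des_child_sub treeR cv))/subD1set.
  rewrite (smallest_uniq mB (smallest_des _)); last by case/setD1P: cV.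
  by rewrite sub_set2 des_refl cdes -Ev edge_parent.
case=> /(tree_edge treeR)[c cV ->]; rewrite sub_set2 => /andP[pv cv].
have cNv : c != v.
  apply: contraTneq pv => <-; exact: child_notin (child_parent cV).
have [d dv cd] := des_childP treeR cv cNv; have [_ Ev] := childP _ _ _ _ dv.
apply/(k_recP _ _ _ vS); exists (des d R); first by rewrite dfpG // mem_child_blocks.
have [-> | cNd] := eqVneq c d; [left | right].
  by exists d; rewrite ?Ev ?smallest_des //; have [/setD1P[]] := childP _ _ _ _ dv.
have [_ pd] := in_des_parent treeR cd cNd.
by rewrite IHc // in_restr edge_parent // sub_set2 pd.
Qed.

End IncreasingTree.
End Ordered.

Theorem theorem1 (disp : Order.disp_t) (T : finOrderType disp)
    (V : {set T}) (r : T) (G : graph T) (R : rooted_graph T)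
    (hr : is_smallest r V)
    (hG : is_graph V G) (hGc : connected V G)
    (hR : rooted_tree V R) (hRinc : increasing V R)
    (hRG : tree_connected V G R) :
  [<-> (r, k V G) = R;
       forall v : T, v \in V ->
         connected (des v R) (restr G (des v R)) /\
         depth_first_partition (des v R) (restr G (des v R)) v =
         depth_first_partition (des v R) (restr R.2 (des v R)) v;
       exists E : T -> {set {set T}},
         (forall v : T, v \in V :\ r -> E v != set0 /\ E v \subset J V v R) /\
         G = \bigcup_(v in V :\ r) E v].
Proof.
have [rootV gR _ _] := hR; have VE := des_root hR.
have rE : R.1 = r.
  by apply: (smallest_uniq _ hr); rewrite -VE; apply: (smallest_des hRinc rootV).
tfae.
- move=> kE v vV; rewrite !depth_first_partition_restr.
  apply: (k_rec_eq_tree hR hRinc (n := #|V|) (v := R.1)); rewrite ?VE //.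
    by rewrite restr_id.
  by rewrite restr_id // -kE.
- move=> dfpG; exists (fun v => J V v R :&: G); rewrite -rE; split.
    by move=> v vV; rewrite subsetIl hRG.
  apply/setP=> e; apply/idP/bigcupP => [eG | [v _ /setIP[]] //].
  have [|c cV eJ] := edge_in_J hR hG _ eG; last by exists c; rewrite // inE eJ.
  move=> v vV; have [_] := dfpG v vV; rewrite !depth_first_partition_restr => ->.
  exact: tree_depth_first_partition.
case=> E [EJ GE].
have dfpG : {in V, forall v,
    depth_first_partition (des v R) G v = child_blocks V R v}.
  move=> v vV; apply: (proj2 (ancestral_graph hR hRG _ vV)) => e.
  rewrite GE => /bigcupP[c cV eE]; exists c; first by rewrite rE.
  by have [_ /subsetP] := EJ c cV; apply.
have := k_rec_des hR hRinc dfpG rootV (leqnn _).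
by rewrite VE restr_id // -/(k V G) -rE => ->; case: (R).
Qed.
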